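(* Let $d\ge 1$, let $\mathcal{A}$ be a finite alphabet, and let $\mu$ be a stationary $\mathbb{Z}^d$ Markov random field on $\mathcal{A}^{\mathbb{Z}^d}$ that satisfies strong spatial mixing. Then $$\big|H_\mu(\{\mathbf{0}\}\mid U_n)-H_\mu(\{\mathbf{0}\}\mid\partial S_n)\big| = e^{-\Omega(n)},$$ i.e. there is a constant $c>0$ such that for all sufficiently large $n$ the left-hand side is at most $e^{-cn}$.
   Context: $\mathbb{Z}^d$ is viewed as the graph in which $u,v$ are adjacent iff $\sum_{i=1}^d|u_i-v_i|=1$. For $S\subset\mathbb{Z}^d$, the boundary $\partial S$ is the set of $v\in\mathbb{Z}^d\setminus S$ adjacent to some element of $S$. An alphabet $\mathcal{A}$ is a finite set with at least two elements. For $S\subset \mathbb{Z}^d$, an element of $\mathcal{A}^S$ is a configuration with shape $S$; $w|_T$ denotes restriction to $T$. A $\mathbb{Z}^d$-measure is a Borel probability measure on $\mathcal{A}^{\mathbb{Z}^d}$ (product topology); for a configuration $w$ on a finite shape $S$, $\mu(w)$ denotes the measure of the cylinder set $\{x: x|_S=w\}$, and similarly for conditional measures. $\mu$ is stationary if it is invariant under all translations of $\mathbb{Z}^d$. A $\mathbb{Z}^d$-measure $\mu$ is a $\mathbb{Z}^d$ Markov random field (MRF) if for any finite $S\subset\mathbb{Z}^d$, any $\eta\in\mathcal{A}^S$, any finite $T$ with $\partial S\subseteq T\subseteq\mathbb{Z}^d\setminus S$, and any $\delta\in\mathcal{A}^T$ with $\mu(\delta)>0$, one has $\mu(\eta\mid\delta|_{\partial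 S})=\mu(\eta\mid\delta)$. For configurations $y,z\in\mathcal{A}^T$ on a finite set $T$, $D(y,z)=\{v: y_v\ne z_v\}$. $d(\cdot,\cdot)$ denotes $L^1$ distance on $\mathbb{Z}^d$ (between sets: the minimum distance; if $D(y,z)=\varnothing$ the distance is $+\infty$). A stationary $\mathbb{Z}^d$ MRF $\mu$ satisfies strong spatial mixing (SSM) if there exist constants $C,\alpha>0$ such that for any finite $V\subset\mathbb{Z}^d$, $u\in V$, $\partial V\subseteq T\subset V\cup\partial V$, $x\in\mathcal{A}^{\{u\}}$, and $y,z\in\mathcal{A}^T$ with $\mu(y),\mu(z)>0$, one has $|\mu(x\mid y)-\mu(x\mid z)|\le Ce^{-\alpha d(\{u\},D(y,z))}$. Conditional entropy: for disjoint finite $S,T$, $H_\mu(S\mid T)=\sum_{w\in\mathcal{A}^{S\cup T},\,\mu(w|_T)>0}-\mu(w)\log\frac{\mu(w)}{\mu(w|_T)}$ (terms with $\mu(w)=0$ are omitted). Lexicographic order on $\mathbb{Z}^d$: $x\prec y$ if for some $1\le k\le d$, $x_i=y_i$ for $i<k$ and $x_k<y_k$. $\mathbf{0}$ is the origin, $\mathcal{P}^+=\{z\in\mathbb{Z}^d: z\succeq\mathbf{0}\}$, $B_n=[-n,n]^d\cap\mathbb{Z}^d$, $S_n=B_n\cap\mathcal{P}^+$, and $U_n=B_n\cap\partial\mathcal{P}^+$. *)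

(* Defs.v *)
From HB Require Import structures.
From mathcomp Require Export all_boot all_order all_algebra.
From mathcomp Require Export finmap.
From mathcomp Require Import zify.
From mathcomp Require Export all_classical all_reals all_analysis.
Export Order.TTheory GRing.Theory Num.Theory.
Export numFieldNormedType.Exports.

Set Implicit Arguments.
Unset Strict Implicit.
Unset Printing Implicit Defensive.

Local Open Scope classical_set_scope.
Local Open Scope ring_scope.

(* Measurable types are pointed in the library, so a nonempty finite alphabet
   has to carry a distinguished letter. No definition below refers to it. *)
#[short(type="finPointedType")]
HB.structure Definition FinPointed := {T of Finite T & Pointed T}.

Notation site d := 'rV[int]_d.

Section Lattice.
Variable d : nat.
Implicit Types (u v : site d) (S T : set (site d)).

Definition l1dist u v : nat := (\sum_(i < d) absz (u 0 i - v 0 i)%R)%N.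

Definition adjacent u v : Prop := l1dist u v = 1%N.

Definition boundary S : set (site d) :=
  [set v | ~ S v /\ exists2 u, S u & adjacent u v].

Definition lexlt u v : Prop :=
  exists k : 'I_d, (forall i : 'I_d, (i < k)%N -> u 0 i = v 0 i) /\
    u 0 k < v 0 k.

Definition Pplus : set (site d) := [set z | z = 0 \/ lexlt 0 z].

Definition box (n : nat) : set (site d) :=
  [set v | forall i : 'I_d, `|v 0 i| <= n%:Z].

(* [fset_set] is the empty set on infinite sets; [finite_boundary] and
   [finite_box] show that it is only used on finite ones. *)
Definition fboundary (S : {fset site d}) : {fset site d} :=
  fset_set (boundary [set` S]).

Definition Sn (n : nat) : {fset site d} := fset_set (box n `&` Pplus).

Definition Un (n : nat) : {fset site d} := fset_set (box n `&` boundary Pplus).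

Lemma finite_box n : finite_set (box n).
Proof.
pose f (g : {ffun 'I_d -> 'I_(n + n).+1}) : site d :=
  \row_i ((g i : nat)%:Z - n%:Z).
apply: (@sub_finite_set _ _ (f @` setT)); last exact: finite_image.
move=> v vn.
have vi i : (absz (v 0 i + n%:Z)%R < (n + n).+1)%N.
  by have := vn i; rewrite ltnS => ?; lia.
exists [ffun i => Ordinal (vi i)] => //.
apply/rowP => i; rewrite mxE ffunE /=.
by have := vn i => ?; lia.
Qed.

Lemma finite_boundary (S : {fset site d}) : finite_set (boundary [set` S]).
Proof.
apply: (@sub_finite_set _ _
  ((fun p : site d * site d => p.1 + p.2) @` ([set` S] `*` box 1))).
  move=> v [_ [u Su uv]]; exists (u, v - u); last by rewrite /= addrC subrK.
  split => //= i; rewrite !mxE.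
  have : (absz (u 0 i - v 0 i)%R <= l1dist u v)%N.
    by rewrite /l1dist (bigD1 i) //= leq_addr.
  by rewrite uv; move: (u 0 i) (v 0 i) => a b; lia.
by apply: finite_image; apply: finite_setX; [exact: finite_fset|exact: finite_box].
Qed.

End Lattice.

(* Infimum of the distances, hence [+oo] as soon as [S] or [T] is empty. *)
Definition setdist (R : realType) (d : nat) (S T : set (site d)) : \bar R :=
  ereal_inf [set ((l1dist u v)%:R : R)%:E | u in S & v in T].

Definition configuration (d : nat) (A : finPointedType) : Type :=
  prod_topology (fun _ : site d => discrete_topology A).

HB.instance Definition _ d A := Topological.on (configuration d A).
HB.instance Definition _ d A := Pointed.on (configuration d A).

(* Borel probability measures for the product of the discrete topologies. *)
Notation Zmeasure R d A :=
  (probability (g_sigma_algebraType (@open (configuration d A))) R).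

Definition cylinder (d : nat) (A : finPointedType) (S : {fset site d})
    (w : {ffun S -> A}) : set (configuration d A) :=
  [set x | forall v : S, x (val v) = w v].

Definition restrict (d : nat) (A : finPointedType) (S T : {fset site d})
    (sTS : (T `<=` S)%fset) (w : {ffun S -> A}) : {ffun T -> A} :=
  [ffun v => w (fincl sTS v)].

Definition translate (d : nat) (A : finPointedType) (v : site d)
    (x : configuration d A) : configuration d A :=
  fun u => x (u + v).

Definition disagreement (d : nat) (A : finPointedType) (T : {fset site d})
    (y z : {ffun T -> A}) : set (site d) :=
  [set val v | v in [set v : T | y v != z v]].

Section Measures.
Variables (R : realType) (d : nat) (A : finPointedType) (mu : Zmeasure R d A).
Implicit Types S T V : {fset site d}.

Definition Prob S (w : {ffun S -> A}) : R := fine (mu (cylinder w)).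

Definition condProb S T (x : {ffun S -> A}) (y : {ffun T -> A}) : R :=
  fine (mu (cylinder x `&` cylinder y)) / Prob y.

Definition stationary : Prop :=
  forall (v : site d) (B : set (configuration d A)), <<s open >> B ->
    mu (translate v @^-1` B) = mu B.

Definition MRF : Prop :=
  forall S (eta : {ffun S -> A}) T (bT : (fboundary S `<=` T)%fset),
  [disjoint T & S]%fset ->
  forall delta : {ffun T -> A}, 0 < Prob delta ->
  condProb eta (restrict bT delta) = condProb eta delta.

Definition SSM : Prop :=
  exists C alpha : R, [/\ 0 < C, 0 < alpha &
  forall V (u : site d), u \in V ->
  forall T, (fboundary V `<=` T)%fset -> (T `<=` V `|` fboundary V)%fset ->
  forall (x : {ffun [fset u]%fset -> A}) (y z : {ffun T -> A}),
  0 < Prob y -> 0 < Prob z ->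
  (`|condProb x y - condProb x z|%:E <=
    C%:E * expeR (- (alpha%:E * setdist R [set u] (disagreement y z))))%E].

Definition condEntropy S T : R :=
  \sum_(w : {ffun (S `|` T)%fset -> A} |
        (0 < Prob (restrict (fsubsetUr S T) w)) && (0 < Prob w))
    - (Prob w * ln (Prob w / Prob (restrict (fsubsetUr S T) w))).

End Measures.

(* Main.v *)
Require Import Defs.
From mathcomp Require Import zify ring lra.

(* For [n > 0], [Un n] is the part of the boundary of [Sn n] inside the box, so
   two configurations on that boundary which agree on [Un n] only differ at
   distance more than [n] from the origin. By strong spatial mixing the law of
   the letter at the origin given such a configuration varies by at most
   [C e^{-an}]; the law given the restriction to [Un n], being an average of
   these, is equally close. The averaging also makes the entropies differ by
   [O(C e^{-an})]: the logarithmic singularity at small probabilities is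
   compensated by the weights. *)

Set Implicit Arguments.
Unset Strict Implicit.
Unset Printing Implicit Defensive.

Local Open Scope classical_set_scope.
Local Open Scope ring_scope.

(** * Cylinder sets and restrictions of patterns *)

Section Cylinders.
Variables (d : nat) (A : finPointedType).
Implicit Types S T : {fset site d}.

Lemma restrict_restrict S T U (sTS : (T `<=` S)%fset) (sUT : (U `<=` T)%fset)
    (sUS : (U `<=` S)%fset) (w : {ffun S -> A}) :
  restrict sUT (restrict sTS w) = restrict sUS w.
Proof. by apply/ffunP => v; rewrite !ffunE; congr (w _); apply: val_inj. Qed.

Lemma cylinder_restrict S T (sTS : (T `<=` S)%fset) (w : {ffun S -> A}) :
  cylinder w `<=` cylinder (restrict sTS w).
Proof. by move=> x xw v; rewrite ffunE -xw. Qed.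

Lemma cylinder_restrict_eq S T (sTS : (T `<=` S)%fset) (w : {ffun S -> A})
    (y : {ffun T -> A}) x :
  cylinder w x -> cylinder y x -> restrict sTS w = y.
Proof. by move=> xw xy; apply/ffunP => v; rewrite ffunE -xw -xy. Qed.

Lemma cylinderU S T (w : {ffun (S `|` T)%fset -> A}) :
  cylinder (restrict (fsubsetUl S T) w) `&`
    cylinder (restrict (fsubsetUr S T) w) = cylinder w.
Proof.
apply/seteqP; split=> [x [xS xT] [v vST]|x xw]; last first.
  by split; apply: cylinder_restrict.
have := vST; rewrite in_fsetU => /orP[vS|vT].
  by have := xS [` vS]%fset; rewrite ffunE /= => ->;
    congr (w _); apply: val_inj.
by have := xT [` vT]%fset; rewrite ffunE /= => ->; congr (w _); apply: val_inj.
Qed.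

Lemma restrictU_inj S T (w w' : {ffun (S `|` T)%fset -> A}) :
  restrict (fsubsetUl S T) w = restrict (fsubsetUl S T) w' ->
  restrict (fsubsetUr S T) w = restrict (fsubsetUr S T) w' -> w = w'.
Proof.
move=> /ffunP eS /ffunP eT; apply/ffunP => -[v vST].
have := vST; rewrite in_fsetU => /orP[vS|vT].
  have := eS [` vS]%fset; rewrite !ffunE.
  by rewrite (_ : fincl _ _ = [` vST]%fset) //; apply: val_inj.
have := eT [` vT]%fset; rewrite !ffunE.
by rewrite (_ : fincl _ _ = [` vST]%fset) //; apply: val_inj.
Qed.

(** A cylinder is a finite intersection of preimages of single letters under coordinate projections,
    which are continuous for the product topology. *)
Lemma measurable_cylinder S (w : {ffun S -> A}) :
  measurable
    (cylinder w : set (g_sigma_algebraType (@open (configuration d A)))).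
Proof.
rewrite (_ : cylinder w = \bigcap_(v in [set: S])
    [set x : configuration d A | x (val v) = w v]); last first.
  by apply/seteqP; split=> [x xw v _|x xw v]; apply: xw.
apply: fin_bigcap_measurable; first exact: finite_finset.
move=> v _; apply: sub_sigma_algebra.
have cproj :=
  @proj_continuous _ (fun _ : site d => discrete_topology A) (val v).
by have := (@continuousP (configuration d A) (discrete_topology A) _).1 cproj _
  (@discrete_open (discrete_topology A) [set w v]).
Qed.

End Cylinders.

(** * Marginals and conditional probabilities *)

Section Marginals.
Variables (R : realType) (d : nat) (A : finPointedType) (mu : Zmeasure R d A).
Implicit Types S T : {fset site d}.

Local Notation mes B :=
  (measurable (B : set (g_sigma_algebraType (@open (configuration d A))))).

(** The cylinders over a fixed finite shape form a finite partition of the configuration space. *)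
Lemma fine_mu_cylinders S (B : set (configuration d A)) : mes B ->
  fine (mu B) = \sum_(w : {ffun S -> A}) fine (mu (B `&` cylinder w)).
Proof.
move=> mB.
have mBc (w : {ffun S -> A}) : mes (B `&` cylinder w).
  by apply: measurableI => //; apply: measurable_cylinder.
rewrite sum_fine; last by move=> w _; apply: fin_num_measure.
congr fine.
have {1}-> : B = \bigcup_(w in [set: {ffun S -> A}]) (B `&` cylinder w).
  apply/seteqP; split=> [x Bx|x [w _ []//]].
  by exists [ffun v : S => x (val v)] => //; split=> // v; rewrite ffunE.
rewrite measure_fin_bigcup//=.
- rewrite (fsbigE (index_enum {ffun S -> A})) ?index_enum_uniq//.
    by apply: eq_bigl => w; rewrite in_setT.
  by move=> w _; rewrite mem_index_enum.
- apply/trivIsetP => w w' _ _ ww'; apply/seteqP; split=> // x [[_ xw] [_ xw']].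
  by move/eqP: ww'; apply; apply/ffunP => v; rewrite -xw -xw'.
Qed.

(** A cylinder over [S] lies inside [cylinder y] if its pattern extends [y], and is disjoint from it
    otherwise. *)
Lemma fine_mu_marginal S T (sTS : (T `<=` S)%fset) (B : set (configuration d A))
    (y : {ffun T -> A}) : mes B ->
  fine (mu (B `&` cylinder y)) =
  \sum_(w : {ffun S -> A} | restrict sTS w == y) fine (mu (B `&` cylinder w)).
Proof.
move=> mB; rewrite (@fine_mu_cylinders S); last first.
  by apply: measurableI => //; apply: measurable_cylinder.
rewrite (bigID (fun w => restrict sTS w == y)) /= [X in _ + X]big1 ?addr0.
  apply: eq_bigr => w /eqP wy; rewrite -setIA; congr (fine (mu (_ `&` _))).
  by apply: setIidr; rewrite -wy; apply: cylinder_restrict.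
move=> w /eqP wy; rewrite (_ : _ `&` _ = set0) ?measure0//.
apply/seteqP; split=> // x [[_ xy] xw]; apply: wy.
exact: cylinder_restrict_eq xw xy.
Qed.

Lemma Prob_ge0 S (w : {ffun S -> A}) : 0 <= Prob mu w.
Proof. by apply: fine_ge0. Qed.

Lemma Prob_marginal S T (sTS : (T `<=` S)%fset) (y : {ffun T -> A}) :
  Prob mu y = \sum_(w : {ffun S -> A} | restrict sTS w == y) Prob mu w.
Proof.
rewrite /Prob -[cylinder y]setTI (@fine_mu_marginal S T sTS)//.
by apply: eq_bigr => w _; rewrite setTI.
Qed.

Lemma Prob_sum1 S : \sum_(w : {ffun S -> A}) Prob mu w = 1.
Proof.
transitivity (fine (mu setT)); last by rewrite probability_setT.
rewrite (@fine_mu_cylinders S)//.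
by apply: eq_bigr => w _; rewrite setTI.
Qed.

Lemma le_Prob_restrict S T (sTS : (T `<=` S)%fset) (w : {ffun S -> A}) :
  Prob mu w <= Prob mu (restrict sTS w).
Proof.
rewrite (Prob_marginal sTS) (bigD1 w)//= lerDl.
by apply: sumr_ge0 => *; apply: Prob_ge0.
Qed.

Lemma sum_Prob_restrict S T (sTS : (T `<=` S)%fset) (f : {ffun T -> A} -> R) :
  \sum_(w : {ffun S -> A}) Prob mu w * f (restrict sTS w) =
  \sum_(y : {ffun T -> A}) Prob mu y * f y.
Proof.
rewrite (partition_big (restrict sTS) predT)//=; apply: eq_bigr => y _.
rewrite (Prob_marginal sTS) mulr_suml.
by apply: eq_bigr => w /eqP ->.
Qed.

(** A pattern on the union is determined by its two parts, so each [y] on [T] has at most as many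
    extensions as there are patterns on [S]; the weights [Prob mu y] sum to 1. *)
Lemma sum_Prob_restrictr S T :
  \sum_(w : {ffun (S `|` T)%fset -> A}) Prob mu (restrict (fsubsetUr S T) w)
    <= #|{ffun S -> A}|%:R.
Proof.
rewrite (partition_big (restrict (fsubsetUr S T)) predT)//=.
rewrite -[leRHS]mulr1 -[X in _ * X](Prob_sum1 T) mulr_sumr.
apply: ler_sum => y _.
under eq_bigr => w /eqP -> do [].
rewrite sumr_const -[leLHS]mulr_natl; apply: ler_wpM2r; first exact: Prob_ge0.
rewrite ler_nat -(@card_in_imset _ _ (restrict (fsubsetUl S T))) ?max_card//.
move=> w w' wy wy' ww'; apply: restrictU_inj => //.
by transitivity y; [apply/eqP|apply/esym/eqP].
Qed.

Lemma fine_mu_cylinderI_null S T (x : {ffun S -> A}) (y : {ffun T -> A}) :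
  Prob mu y = 0 -> fine (mu (cylinder x `&` cylinder y)) = 0.
Proof.
have my := measurable_cylinder y; have mx := measurable_cylinder x.
have mxy : mes (cylinder x `&` cylinder y) by apply: measurableI.
move=> y0; apply/le_anti; rewrite fine_ge0// -{1}y0 fine_le ?fin_num_measure//.
by apply: le_measure; rewrite ?inE//; apply: subIsetr.
Qed.

(** Conditioning on the smaller shape averages [condProb mu x z] over the extensions [z] with
    weights [Prob mu z]. Each term is within [e] of the value at [y], and null extensions contribute
    0. *)
Lemma condProb_restrict S T T' (sT : (T `<=` T')%fset) (x : {ffun S -> A})
    (y : {ffun T' -> A}) (e : R) :
  (forall z : {ffun T' -> A}, restrict sT y = restrict sT z -> 0 < Prob mu z ->
    `|condProb mu x y - condProb mu x z| <= e) ->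
  0 < Prob mu y ->
  `|condProb mu x (restrict sT y) - condProb mu x y| <= e.
Proof.
move=> close y0; set p := condProb mu x y; set y1 := restrict sT y.
have y10 : 0 < Prob mu y1 := lt_le_trans y0 (le_Prob_restrict _ _).
rewrite -(ler_pM2r y10) -{1}(gtr0_norm y10) -normrM mulrBl.
rewrite /condProb divfK ?gt_eqF// (Prob_marginal sT).
rewrite (@fine_mu_marginal _ _ sT); last exact: measurable_cylinder.
rewrite !mulr_sumr -sumrB; apply: le_trans (ler_norm_sum _ _ _) _.
apply: ler_sum => z /eqP zy; have [z0|] := ltP 0 (Prob mu z).
  rewrite -[X in `|X - _|](@divfK _ (Prob mu z)) ?gt_eqF// -mulrBl normrM.
  rewrite (gtr0_norm z0); apply: ler_wpM2r; first exact: ltW.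
  by rewrite distrC; apply: close.
move=> z0; have {}z0 : Prob mu z = 0 by apply/le_anti; rewrite z0 Prob_ge0.
by rewrite z0 !mulr0 subr0 fine_mu_cylinderI_null ?normr0.
Qed.

End Marginals.

(** * Geometry of the half-space, the boxes and their boundaries *)

Section Geometry.
Variable d : nat.
Implicit Types u v : site d.

Lemma adjacent_unit_step u v : adjacent u v ->
  exists j : 'I_d, absz (u 0 j - v 0 j)%R = 1%N /\
    forall i, i != j -> u 0 i = v 0 i.
Proof.
move=> uv; have [j uvj] : exists j : 'I_d, u 0 j != v 0 j.
  apply: contrapT => /forallNP e; move: uv; rewrite /adjacent /l1dist big1//.
  by move=> i _; have /negP := e i; rewrite negbK => /eqP ->; rewrite subrr.
exists j; move: uv; rewrite /adjacent /l1dist (bigD1 j)//= => uv.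
move: uv uvj; rewrite -subr_eq0 -absz_eq0.
set r := (\sum_(i < d | i != j) _)%N; move: (absz _) => a uv a0.
have [a1 rest] : a = 1%N /\ r = 0%N by lia.
split=> //.
move=> i ij; move/eqP: rest; rewrite sum_nat_eq0 => /forall_inP/(_ i ij).
by rewrite absz_eq0 subr_eq0 => /eqP.
Qed.

Lemma l1dist_ge_coord u v (i : 'I_d) : (absz (u 0 i - v 0 i)%R <= l1dist u v)%N.
Proof. by rewrite /l1dist (bigD1 i)//= leq_addr. Qed.

Lemma box_or_far n v : box n v \/ (n < l1dist 0 v)%N.
Proof.
have [|far] := pselect (box n v); first by left.
right; have [i vi] : exists i : 'I_d, ~ (`|v 0 i| <= n%:Z).
  by apply/existsNP.
have := l1dist_ge_coord 0 v i; rewrite mxE; lia.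
Qed.

(* A step leaving the box increases the modulus of a nonzero coordinate, hence
   preserves the lexicographic sign. For [n = 0] the coordinate may vanish. *)
Lemma Pplus_neighbour_box n u v : (0 < n)%N ->
  box n v -> ~ Pplus v -> Pplus u -> adjacent u v -> box n u.
Proof.
move=> n0 vn vP uP /adjacent_unit_step [j [uvj uv]] i.
have [->{i}|ij] := eqVneq i j; last by rewrite uv//; apply: vn.
have vj := vn j; have [//|uj] := boolP (`|u 0 j| <= n%:Z); exfalso.
have {uvj uj vj} uj1 : v 0 j = n%:Z /\ u 0 j = n%:Z + 1 \/
  v 0 j = - n%:Z /\ u 0 j = - n%:Z - 1 by lia.
case: uP => [u0|[k [uk0 uk]]].
  by move: uj1; rewrite u0 mxE; lia.
apply: vP; right; rewrite mxE in uk.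
(* The coordinates of [u] before [k] vanish while [u 0 j] does not, so [k <= j], and [k] also
   witnesses that [v] is lexicographically positive. *)
have [kj|jk] := leqP k j; last by move: (uk0 j jk); rewrite mxE; lia.
exists k; split.
  move=> i ik; rewrite uk0// uv//; apply/eqP => ij.
  by move: ik kj; rewrite ij; lia.
rewrite mxE; have [kj'|kj'] := eqVneq k j; last by rewrite -uv.
by rewrite kj' in uk *; lia.
Qed.

Lemma in_Un n v : (v \in Un d n) = (v \in box n `&` boundary (@Pplus d)).
Proof.
rewrite in_fset_set//; apply: (@sub_finite_set _ _ (box n)) => [w []//|].
exact: finite_box.
Qed.

Lemma in_Sn n v : (v \in Sn d n) = (v \in box n `&` @Pplus d).
Proof.
rewrite in_fset_set//; apply: (@sub_finite_set _ _ (box n)) => [w []//|].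
exact: finite_box.
Qed.

Lemma in_fboundary (S : {fset site d}) v :
  (v \in fboundary S) = (v \in boundary [set` S]).
Proof. by rewrite in_fset_set//; apply: finite_boundary. Qed.

Lemma zero_in_Sn n : 0 \in Sn d n.
Proof. by rewrite in_Sn inE; split=> [i|]; [rewrite mxE normr0|left]. Qed.

Lemma Un_sub_boundary_Sn n : (0 < n)%N -> (Un d n `<=` fboundary (Sn d n))%fset.
Proof.
move=> n0; apply/fsubsetP => v; rewrite in_Un in_fboundary !inE.
move=> [vn [vP [u uP uv]]]; split; first by rewrite /= in_Sn inE => -[].
exists u => //=; rewrite in_Sn inE; split=> //.
exact: Pplus_neighbour_box vn vP uP uv.
Qed.

(** A site of this boundary lying in the box must be outside [Pplus]; being adjacent to a site of
    [Sn], hence of [Pplus], it would belong to [Un]. *)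
Lemma boundary_Sn_far n v : v \in fboundary (Sn d n) -> v \notin Un d n ->
  (n < l1dist 0 v)%N.
Proof.
rewrite in_fboundary in_Un inE => -[vS [u uS uv]] vU.
have [vn|//] := box_or_far n v; exfalso.
move: uS; rewrite /= in_Sn inE => -[un uP].
move/negP: vU; apply; rewrite inE; split=> //; split; last by exists u.
by move=> vP; apply: vS; rewrite /= in_Sn inE.
Qed.

(** Agreement on [Un] leaves disagreements only on the far part of the boundary; if there are none,
    the infimum is [+oo]. *)
Lemma setdist_disagreement_ge (R : realType) (A : finPointedType) n
    (s : (Un d n `<=` fboundary (Sn d n))%fset)
    (y z : {ffun fboundary (Sn d n) -> A}) :
  restrict s y = restrict s z ->
  (n%:R%:E <= setdist R [set (0 : site d)%R] (disagreement y z))%E.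
Proof.
move=> /ffunP yz; apply: le_ereal_inf_tmp => _ /= [_ -> [_ [v yzv <-] <-]].
rewrite lee_fin ler_nat ltnW// boundary_Sn_far ?(valP v)//.
apply/negP => vU; move/negP: yzv; apply; have := yz [` vU]%fset; rewrite !ffunE.
by rewrite (_ : fincl _ _ = v) => [->//|]; apply: val_inj.
Qed.

End Geometry.

(** This is [ln (1 + t) <= t] at [t = (p - q) / q]. The factor [x / q] is kept so that it can be
    summed without a lower bound on [q]. *)
Lemma mulr_lnB_le (R : realType) (x p q e : R) :
  0 <= x -> 0 < p -> 0 < q -> p - q <= e -> x * (ln p - ln q) <= e * (x / q).
Proof.
move=> x0 p0 q0 pqe; rewrite mulrCA; apply: ler_wpM2l => //.
rewrite -ln_div ?posrE//; have -> : p / q = 1 + (p - q) / q.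
  by field; rewrite gt_eqF.
apply: (@le_trans _ _ ((p - q) / q)); last by rewrite ler_pM2r ?invr_gt0.
apply: le_ln1Dx; rewrite -subr_gt0; have -> : (p - q) / q - -1 = p / q.
  by field; rewrite gt_eqF.
exact: divr_gt0.
Qed.

(** * Comparison of conditional entropies *)

Section Entropy.
Variables (R : realType) (d : nat) (A : finPointedType) (mu : Zmeasure R d A).
Implicit Types S T : {fset site d}.

(** Minus its logarithm is the conditional information function, whose mean is the conditional
    entropy. *)
Definition condProbU S T (w : {ffun (S `|` T)%fset -> A}) : R :=
  condProb mu (restrict (fsubsetUl S T) w) (restrict (fsubsetUr S T) w).

Lemma condProbUE S T (w : {ffun (S `|` T)%fset -> A}) :
  condProbU w = Prob mu w / Prob mu (restrict (fsubsetUr S T) w).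
Proof. by rewrite /condProbU /condProb cylinderU. Qed.

Lemma condProbU_gt0 S T (w : {ffun (S `|` T)%fset -> A}) :
  0 < Prob mu w -> 0 < condProbU w.
Proof.
move=> w0; rewrite condProbUE divr_gt0//.
exact: lt_le_trans w0 (le_Prob_restrict _ _ _).
Qed.

Lemma condEntropyE S T : condEntropy mu S T =
  - \sum_(w : {ffun (S `|` T)%fset -> A}) Prob mu w * ln (condProbU w).
Proof.
rewrite /condEntropy -sumrN [RHS](bigID (fun w => 0 < Prob mu w))/=.
rewrite [X in _ = _ + X]big1 ?addr0; last first.
  move=> w w0; rewrite (_ : Prob mu w = 0) ?mul0r ?oppr0//.
  by apply/le_anti; rewrite Prob_ge0 leNgt w0.
apply: eq_big => w; last by move=> _; rewrite condProbUE.
by apply/andb_idl => w0; apply: lt_le_trans w0 (le_Prob_restrict _ _ _).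
Qed.

Lemma condProbU_ratio_le S T (w : {ffun (S `|` T)%fset -> A}) :
  Prob mu w / condProbU w <= Prob mu (restrict (fsubsetUr S T) w).
Proof.
rewrite condProbUE invf_div mulrCA; have [->|w0] := eqVneq (Prob mu w) 0.
  by rewrite mul0r mulr0 Prob_ge0.
by rewrite divff// mulr1.
Qed.

(* The difference is [\sum_w P w * (ln p2 - ln p1)], where [p1] and [p2] are the
   two conditional probabilities. Since [ln p2 - ln p1 <= (p2 - p1) / p1] and
   symmetrically, it is enough that [\sum_w P w / p_i <= #|A^S|]. *)
Lemma condEntropy_close S T1 T2 (s12 : (T1 `<=` T2)%fset) (e : R) : 0 <= e ->
  (forall (x : {ffun S -> A}) (y z : {ffun T2 -> A}),
    restrict s12 y = restrict s12 z -> 0 < Prob mu y -> 0 < Prob mu z ->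
    `|condProb mu x y - condProb mu x z| <= e) ->
  `|condEntropy mu S T1 - condEntropy mu S T2| <= e * #|{ffun S -> A}|%:R.
Proof.
move=> e0 close; have sU : (S `|` T1 `<=` S `|` T2)%fset by apply: fsetUS.
pose p1 (w : {ffun (S `|` T2)%fset -> A}) := condProbU (restrict sU w).
have close1 w : 0 < Prob mu w -> `|p1 w - condProbU w| <= e.
  move=> w0; rewrite /p1 /condProbU.
  (* Restriction to [T1] is factored through [T2], the form required by [condProb_restrict]. *)
  rewrite (restrict_restrict _ _ (fsubsetUl S T2)).
  have s1 : (T1 `<=` S `|` T2)%fset by apply: fsubset_trans s12 (fsubsetUr _ _).
  rewrite (restrict_restrict _ _ s1) -(restrict_restrict (fsubsetUr S T2) s12).
  have y0 := lt_le_trans w0 (le_Prob_restrict mu (fsubsetUr S T2) w).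
  by apply: condProb_restrict => // z yz z0; apply: close.
have p1_gt0 w : 0 < Prob mu w -> 0 < p1 w.
  by move=> w0; apply/condProbU_gt0/(lt_le_trans w0)/le_Prob_restrict.
have sum1 : \sum_w Prob mu w / p1 w <= #|{ffun S -> A}|%:R.
  rewrite (sum_Prob_restrict mu sU (fun w => (condProbU w)^-1)).
  apply: le_trans _ (sum_Prob_restrictr mu S T1).
  by apply: ler_sum => w _; apply: condProbU_ratio_le.
have sum2 : \sum_(w : {ffun (S `|` T2)%fset -> A}) Prob mu w / condProbU w <=
    #|{ffun S -> A}|%:R.
  apply: le_trans _ (sum_Prob_restrictr mu S T2).
  by apply: ler_sum => w _; apply: condProbU_ratio_le.
have null (w : {ffun (S `|` T2)%fset -> A}) :
    ~~ (0 < Prob mu w) -> Prob mu w = 0.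
  by move=> w0; apply/le_anti; rewrite Prob_ge0 leNgt w0.
(* Both entropies become averages over patterns on the larger shape, with the same weights. *)
rewrite !condEntropyE -(sum_Prob_restrict mu sU (fun w => ln (condProbU w))).
rewrite opprK addrC -sumrB ler_norml; apply/andP; split.
  rewrite lerNl -sumrN; apply: le_trans _ (ler_wpM2l e0 sum2).
  rewrite mulr_sumr; apply: ler_sum => w _.
  have [w0|/null->] := boolP (0 < Prob mu w).
    rewrite opprB -mulrBr; apply: mulr_lnB_le;
      rewrite ?Prob_ge0 ?p1_gt0 ?condProbU_gt0//.
    by apply: le_trans (ler_norm _) _; apply: close1.
  by rewrite !mul0r subrr oppr0 mulr0.
apply: le_trans _ (ler_wpM2l e0 sum1).
rewrite mulr_sumr; apply: ler_sum => w _.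
have [w0|/null->] := boolP (0 < Prob mu w); last by rewrite !mul0r subrr mulr0.
rewrite -mulrBr; apply: mulr_lnB_le; rewrite ?Prob_ge0 ?p1_gt0 ?condProbU_gt0//.
by apply: le_trans (ler_norm _) _; rewrite distrC; apply: close1.
Qed.

End Entropy.

(** * Exponential decay from strong spatial mixing *)

Theorem theorem3p2 (R : realType) (d : nat) (hd : (1 <= d)%N)
    (A : finPointedType) (hA : (1 < #|A|)%N) (mu : Zmeasure R d A)
    (mu_stat : stationary mu) (mu_MRF : MRF mu) (mu_SSM : SSM mu) :
  exists2 c : R, 0 < c &
    \forall n \near \oo,
      `|condEntropy mu [fset (0 : site d)]%fset (Un d n)
        - condEntropy mu [fset (0 : site d)]%fset (fboundary (Sn d n))|
      <= expR (- (c * n%:R)).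
Proof.
have [C [a [C0 a0 ssm]]] := mu_SSM.
pose K : R := C * #|{ffun [fset (0 : site d)]%fset -> A}|%:R.
(* Half of the mixing rate is given up to absorb the constant [K] for large [n]. *)
exists (a / 2); first by rewrite divr_gt0.
near=> n.
have n0 : (0 < n)%N by near: n; exact: nbhs_infty_gt.
have Kn : K <= expR (a / 2 * n%:R).
  apply: (@le_trans _ _ (a / 2 * n%:R)); last first.
    by apply: le_trans _ (expR_ge1Dx _); rewrite lerDr.
  rewrite mulrC -ler_pdivrMr ?divr_gt0//.
  by near: n; exact: nbhs_infty_ger.
have s := @Un_sub_boundary_Sn d n n0.
apply: (@le_trans _ _ (C * expR (- (a * n%:R)) *
    #|{ffun [fset (0 : site d)]%fset -> A}|%:R)).
  apply: (@condEntropy_close _ _ _ mu _ _ _ s).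
    by rewrite mulr_ge0 ?expR_ge0// ltW.
  move=> x y z yz y0 z0; rewrite -lee_fin.
  apply: le_trans (ssm (Sn d n) 0 (zero_in_Sn _ _) _ (fsubset_refl _)
    (fsubsetUr _ _) x y z y0 z0) _.
  rewrite EFinM; apply: lee_wpmul2l; first by rewrite lee_fin ltW.
  (* The comparison takes place in the extended reals because the distance is [+oo] when [y = z]. *)
  rewrite -[X in (_ <= X)%E]/(expeR _%:E) lee_expeR EFinN leeN2 EFinM.
  apply: lee_wpmul2l; first by rewrite lee_fin ltW.
  exact: setdist_disagreement_ge yz.
rewrite mulrAC -/K; apply: le_trans (ler_wpM2r (expR_ge0 _) Kn) _.
rewrite -expRD ler_expR; lra.
Unshelve. all: by end_near.
Qed.
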